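(* Let $\mathbf{k}$ be a field of characteristic not $2$ and not $3$, let $X$ and $\Theta$ be disjoint sets, and fix a total ordering of $X\cup\Theta$ such that $\theta<x$ for all $\theta\in\Theta$ and $x\in X$. Let $F=\mathcal{F}\mathcal{A}_2[X\cup\Theta]=F_0\oplus F_1$ be the free associative $\mathcal{Z}_2$-algebra on $X\cup\Theta$ over $\mathbf{k}$, equipped with the bullet product $a\bullet b=\frac12(ab_0+b_0a)$, where $b_0$ is the even component of $b$, and let $\ast$ be the reversal involution of $F$. Then the set $\mathcal{H}(F,\ast)=\{a\in F \mid a^\ast=a\}$ of reversible elements, which is a right unital generalized Jordan subalgebra of $(F,+,\bullet)$, coincides with the generalized Jordan subalgebra $\mathcal{H}'$ of $(F,+,\bullet)$ generated by $1$, $X\cup\Theta$, all even tetrads and all odd tetrads.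
   Context: Associative algebras have an identity. An associative $\mathcal{Z}_2$-algebra is an associative algebra $A$ with a vector space decomposition $A=A_0\oplus A_1$ such that $A_0A_0\subseteq A_0$, $A_0A_1+A_1A_0\subseteq A_1$ and $A_1A_1=0$. Writing $b=b_0+b_1$ with $b_i\in A_i$, $b_0$ is called the even component of $b$. A generalized Jordan algebra is a vector space $J$ with a bilinear product $\bullet$ satisfying, for all $x,y,z\in J$: $x\bullet(y\bullet z)=x\bullet(z\bullet y)$; $(y\bullet x)\bullet(x\bullet x)=(y\bullet(x\bullet x))\bullet x$; and $x\bullet(y\bullet(x\bullet x))-(x\bullet y)\bullet(x\bullet x)=2(x\bullet x)\bullet(y\bullet x)-2((x\bullet x)\bullet y)\bullet x$. It is right unital if there is an element $1\in J$ with $x\bullet 1=x$ for all $x\in J$. A generalized Jordan subalgebra is a subspace closed under $\bullet$; the one generated by a subset is the smallest one containing it. Any associative $\mathcal{Z}_2$-algebra is a right unital generalized Jordan algebra under $a\bullet b=\frac12(ab_0+b_0a)$. Free associative $\mathcal{Z}_2$-algebra: $\mathcal{F}\mathcal{A}_2[X\cup\Theta]$ is the quotient of the free unital associative $\mathbf{k}$-algebra on the set $X\cup\Theta$ by the ideal spanned by all monomials (words) in which the number of letters belonging to $\Theta$, counted with multiplicity, is at least $2$. Elements of $X\cup\Theta$ are identified with their images in the quotient. Its even part $F_0$ is spanned by the words with all letters in $X$ (including the empty word $1$), and its odd part $F_1$ is spanned by the words containing exactly one letter from $\Theta$. The reversal involution $\ast$ is the $\mathbf{k}$-linear map on $F$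 with $1^\ast=1$ and $(y_1y_2\cdots y_n)^\ast=y_n\cdots y_2y_1$ for $y_1,\dots,y_n\in X\cup\Theta$. For $y_1,\dots,y_n\in X\cup\Theta$ put $\{y_1,y_2,\dots,y_n\}:=\frac12(y_1y_2\cdots y_n+y_n\cdots y_2y_1)\in F$. An even tetrad is an element $\{x_1,x_2,x_3,x_4\}$ with $x_1<x_2<x_3<x_4$ in $X$; an odd tetrad is an element $\{\theta,x_1,x_2,x_3\}$ with $\theta\in\Theta$ and $x_1<x_2<x_3$ in $X$. *)

(* Defs.v *)
From HB Require Import structures.
From mathcomp Require Import all_boot all_order all_algebra.
From mathcomp Require Import finmap monalg.
From mathcomp Require Import classical_sets.

Set Implicit Arguments.
Unset Strict Implicit.
Unset Printing Implicit Defensive.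

Import GRing.Theory.
Local Open Scope ring_scope.
Local Open Scope quotient_scope.

Definition total_order (T : Type) (le : rel T) : Prop :=
  [/\ reflexive le, antisymmetric le, transitive le & total le].

Definition strict (T : eqType) (le : rel T) : rel T :=
  fun x y => (x != y) && le x y.

Section GeneralizedJordan.
Variables (k : fieldType) (J : lmodType k) (op : J -> J -> J).
Local Notation "x • y" := (op x y) (at level 40, left associativity).

Definition bilinear_op : Prop :=
  (forall y, linear (fun x => x • y)) /\ (forall x, linear (op x)).

Definition gj_algebra : Prop :=
  [/\ bilinear_op,
      forall x y z, x • (y • z) = x • (z • y),
      forall x y, (y • x) • (x • x) = (y • (x • x)) • x
    & forall x y, x • (y • (x • x)) - (x • y) • (x • x)
        = 2%:R *: ((x • x) • (y • x)) - 2%:R *: (((x • x) • y) • x)].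

Definition subspace (V : lmodType k) (P : set V) : Prop :=
  P 0 /\ forall (c : k) u v, P u -> P v -> P (c *: u + v).

Definition gj_subalgebra (P : set J) : Prop :=
  subspace P /\ forall x y, P x -> P y -> P (x • y).

Definition gj_right_unital (P : set J) : Prop :=
  exists2 e, P e & forall x, P x -> x • e = x.

Definition gj_generated (S : set J) : set J := smallest gj_subalgebra S.

Lemma gj_generated_subalgebra (S : set J) : gj_subalgebra (gj_generated S).
Proof.
split; first split.
- by move=> P [[[P0 _] _] _].
- move=> c u v Su Sv P PS; case: (PS) => -[[_ PZ] _] _.
  by apply: PZ; [apply: Su | apply: Sv].
- move=> x y Sx Sy P PS; case: (PS) => -[_ PM] _.
  by apply: PM; [apply: Sx | apply: Sy].
Qed.

End GeneralizedJordan.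

Section Z2Algebra.
Variables (k : fieldType) (A : algType k) (A0 A1 : set A).

Definition z2_algebra : Prop :=
  [/\ subspace A0 /\ subspace A1,
      forall a, exists! b : A * A, [/\ A0 b.1, A1 b.2 & a = b.1 + b.2],
      forall a b, A0 a -> A0 b -> A0 (a * b),
      forall a b, A0 a -> A1 b -> A1 (a * b) /\ A1 (b * a)
    & forall a b, A1 a -> A1 b -> a * b = 0].

End Z2Algebra.

Section FreeZ2Algebra.
Variables (k : fieldType) (X Theta : choiceType).

Definition letter : choiceType := (X + Theta)%type.
Definition word : monomType := {fmonom letter}.
Definition free_alg := {malg k[word]}.

Local Notation "u *w v" := (mmul u v : word) (at level 40, left associativity).
Local Notation one_w := (mone : word).

Definition is_theta (y : letter) : bool := if y is inr _ then true else false.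
Definition thdeg (w : word) : nat := count is_theta w.

Lemma thdeg1 : thdeg one_w = 0%N.
Proof. by rewrite /thdeg fm1. Qed.

Lemma thdegM (u v : word) : thdeg (u *w v) = (thdeg u + thdeg v)%N.
Proof. by rewrite /thdeg fmM count_cat. Qed.

Definition theta_ideal : {pred free_alg} :=
  fun g => all (fun w => 2 <= thdeg w)%N (msupp g : seq word).

Lemma theta_idealP (g : free_alg) :
  reflect (forall w, (thdeg w < 2)%N -> g@_w = 0) (g \in theta_ideal).
Proof.
apply: (iffP allP) => [h w|h w].
  by move=> w2; apply/eqP; rewrite mcoeff_eq0; apply: contraL w2 => /h; rewrite -leqNgt.
by rewrite -mcoeff_neq0 leqNgt; apply: contra => /h ->.
Qed.

(* [theta_ideal] is the span of the words with at least two letters in Theta. *)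
Lemma theta_ideal_span (g : free_alg) :
  g \in theta_ideal <->
  exists2 s : seq (k * word), all (fun p => 2 <= thdeg p.2)%N s
    & g = \sum_(p <- s) << p.1 *g p.2 >>.
Proof.
split=> [gI|[s /allP sI ->]].
  exists [seq (g@_w, w) | w <- (msupp g : seq word)].
    by rewrite all_map; apply: gI.
  by rewrite big_map -monalgE.
apply/theta_idealP => w w2; rewrite raddf_sum /= big_seq big1 // => p /sI.
by rewrite mcoeffU; case: eqP => // ->; rewrite leqNgt w2.
Qed.

Fact theta_ideal_zmod_closed : zmod_closed theta_ideal.
Proof.
split=> [|g h /theta_idealP gI /theta_idealP hI]; apply/theta_idealP => w w2.
  by rewrite mcoeff0.
by rewrite mcoeffB gI // hI // subrr.
Qed.

HB.instance Definition _ :=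
  GRing.isZmodClosed.Build free_alg theta_ideal theta_ideal_zmod_closed.

Lemma theta_idealMl (a g : free_alg) :
  g \in theta_ideal -> a * g \in theta_ideal.
Proof.
move=> /allP gI; apply/allP => w /msuppM_le [u [v [_ vg ->]]].
by rewrite thdegM (leq_trans (gI _ vg)) ?leq_addl.
Qed.

Lemma theta_idealMr (a g : free_alg) :
  g \in theta_ideal -> g * a \in theta_ideal.
Proof.
move=> /allP gI; apply/allP => w /msuppM_le [u [v [ug _ ->]]].
by rewrite thdegM (leq_trans (gI _ ug)) ?leq_addr.
Qed.

(* The quotient is a quotient type, so no representative of a class is canonical:
   the operations below are defined on [repr] and the lemmas [FA2_mulE],
   [FA2_scaleE], [even_part_cls], [star_cls] show they are independent of it. *)
Definition FA2 := Quotient.quot theta_ideal.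
HB.instance Definition _ := GRing.Zmodule.copy FA2 (Quotient.quot theta_ideal).

Definition cls (g : free_alg) : FA2 := \pi_(Quotient.quot theta_ideal) g.

Lemma clsP (g h : free_alg) : reflect (cls g = cls h) (g - h \in theta_ideal).
Proof. by apply: (iffP idP); rewrite Quotient.idealrBE => /eqP. Qed.

Lemma cls_repr (a : FA2) : cls (repr a) = a.
Proof. exact: reprK. Qed.

Lemma repr_cls (g : free_alg) : repr (cls g) - g \in theta_ideal.
Proof. by apply/clsP; rewrite cls_repr. Qed.

Lemma clsD : {morph cls : g h / g + h}.
Proof. by move=> g h; rewrite /cls !piE. Qed.

Lemma clsN : {morph cls : g / - g}.
Proof. by move=> g; rewrite /cls !piE. Qed.

Lemma cls0 : cls 0 = 0.
Proof. by rewrite /cls !piE. Qed.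

Definition FA2_one : FA2 := cls 1.
Definition FA2_mul (a b : FA2) : FA2 := cls (repr a * repr b).
Definition FA2_scale (c : k) (a : FA2) : FA2 := cls (c *: repr a).

Lemma FA2_mulE g h : FA2_mul (cls g) (cls h) = cls (g * h).
Proof.
apply/clsP; set g' := repr _; set h' := repr _.
have -> : g' * h' - g * h = g' * (h' - h) + (g' - g) * h.
  by rewrite mulrBr mulrBl addrA subrK.
by apply: rpredD; [apply: theta_idealMl | apply: theta_idealMr]; apply: repr_cls.
Qed.

Lemma theta_idealZ (c : k) g : g \in theta_ideal -> c *: g \in theta_ideal.
Proof.
move=> /theta_idealP gI; apply/theta_idealP => w w2.
by rewrite mcoeffZ gI // mulr0.
Qed.

Lemma FA2_scaleE c g : FA2_scale c (cls g) = cls (c *: g).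
Proof. by apply/clsP; rewrite -scalerBr; apply/theta_idealZ/repr_cls. Qed.

Lemma FA2_ind (P : FA2 -> Prop) : (forall g, P (cls g)) -> forall a, P a.
Proof. by move=> h a; rewrite -(cls_repr a); apply: h. Qed.

Fact FA2_mulA : associative FA2_mul.
Proof.
by elim/FA2_ind=> a; elim/FA2_ind=> b; elim/FA2_ind=> c; rewrite !FA2_mulE mulrA.
Qed.

Fact FA2_mul1 : left_id FA2_one FA2_mul.
Proof. by elim/FA2_ind=> a; rewrite FA2_mulE mul1r. Qed.

Fact FA2_mulr1 : right_id FA2_one FA2_mul.
Proof. by elim/FA2_ind=> a; rewrite FA2_mulE mulr1. Qed.

Fact FA2_mulDl : left_distributive FA2_mul +%R.
Proof.
elim/FA2_ind=> a; elim/FA2_ind=> b; elim/FA2_ind=> c.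
by rewrite -clsD !FA2_mulE mulrDl clsD.
Qed.

Fact FA2_mulDr : right_distributive FA2_mul +%R.
Proof.
elim/FA2_ind=> a; elim/FA2_ind=> b; elim/FA2_ind=> c.
by rewrite -clsD !FA2_mulE mulrDr clsD.
Qed.

Fact FA2_oner_neq0 : FA2_one != 0.
Proof.
apply/eqP; rewrite -cls0 => /clsP /theta_idealP /(_ one_w).
rewrite thdeg1 subr0 mcoeff1 eqxx => /(_ isT) /eqP.
by rewrite oner_eq0.
Qed.

HB.instance Definition _ := GRing.Zmodule_isNzRing.Build FA2
  FA2_mulA FA2_mul1 FA2_mulr1 FA2_mulDl FA2_mulDr FA2_oner_neq0.

Fact FA2_scaleA c d a : FA2_scale c (FA2_scale d a) = FA2_scale (c * d) a.
Proof. by elim/FA2_ind: a => a; rewrite !FA2_scaleE scalerA. Qed.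

Fact FA2_scale1 : left_id 1 FA2_scale.
Proof. by elim/FA2_ind=> a; rewrite FA2_scaleE scale1r. Qed.

Fact FA2_scaleDr : right_distributive FA2_scale +%R.
Proof.
move=> c; elim/FA2_ind=> a; elim/FA2_ind=> b.
by rewrite -clsD !FA2_scaleE scalerDr clsD.
Qed.

Fact FA2_scaleDl a : {morph FA2_scale^~ a : c d / c + d}.
Proof. by elim/FA2_ind: a => a c d; rewrite !FA2_scaleE scalerDl clsD. Qed.

HB.instance Definition _ := GRing.Zmodule_isLmodule.Build k FA2
  FA2_scaleA FA2_scale1 FA2_scaleDr FA2_scaleDl.

Lemma cls1 : cls 1 = 1. Proof. by []. Qed.

Lemma clsM : {morph cls : g h / g * h}.
Proof. by move=> g h; rewrite -FA2_mulE. Qed.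

Lemma clsZ c : {morph cls : g / c *: g}.
Proof. by move=> g; rewrite -FA2_scaleE. Qed.

Fact FA2_scaleAl (c : k) (a b : FA2) : c *: (a * b) = c *: a * b.
Proof.
by elim/FA2_ind: a => a; elim/FA2_ind: b => b; rewrite -clsM -!clsZ -clsM scalerAl.
Qed.

HB.instance Definition _ := GRing.Lmodule_isLalgebra.Build k FA2 FA2_scaleAl.

Lemma free_alg_scaleAr (c : k) (a b : free_alg) : c *: (a * b) = a * (c *: b).
Proof.
rewrite (malgMEw (fsubset_refl _) (msuppZ_le c b)) malgME scaler_sumr.
apply: eq_bigr => u _; rewrite scaler_sumr; apply: eq_bigr => v _.
by apply/malgP => w; rewrite !mcoeffZ !mcoeffU; case: eqP => _; rewrite ?mulr0n ?mulr0 ?mulr1n // mulrCA.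
Qed.

Fact FA2_scaleAr (c : k) (a b : FA2) : c *: (a * b) = a * (c *: b).
Proof.
by elim/FA2_ind: a => a; elim/FA2_ind: b => b; rewrite -clsM -!clsZ -clsM free_alg_scaleAr.
Qed.

HB.instance Definition _ := GRing.Lalgebra_isAlgebra.Build k FA2 FA2_scaleAr.

Definition gen (y : letter) : FA2 := cls << fmu y >>.

(* [g] has finite support [msupp g], so these are the spans of the words with no
   letter, respectively exactly one letter, in Theta. *)
Definition F_even : set FA2 :=
  fun a => exists2 g : free_alg,
    all (fun w => thdeg w == 0%N) (msupp g : seq word) & a = cls g.
Definition F_odd : set FA2 :=
  fun a => exists2 g : free_alg,
    all (fun w => thdeg w == 1%N) (msupp g : seq word) & a = cls g.

Definition restrict_words (P : pred word) (g : free_alg) : free_alg :=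
  [malg w in msupp g => if P w then g@_w else 0].

Lemma restrict_wordsE P g w :
  (restrict_words P g)@_w = if P w then g@_w else 0.
Proof. by rewrite mcoeffE; case: msuppP => //; rewrite if_same. Qed.

Definition even_part (a : FA2) : FA2 :=
  cls (restrict_words (fun w => thdeg w == 0%N) (repr a)).

Lemma even_part_cls g :
  even_part (cls g) = cls (restrict_words (fun w => thdeg w == 0%N) g).
Proof.
apply/clsP/theta_idealP => w w2; rewrite mcoeffB !restrict_wordsE.
case: ifP; rewrite ?subrr // => _; rewrite -mcoeffB.
exact: (theta_idealP _ (repr_cls g)).
Qed.

Definition homog (d : nat) (g : free_alg) : Prop :=
  forall w, thdeg w != d -> g@_w = 0.

Lemma homogP d g :
  reflect (homog d g) (all (fun w => thdeg w == d) (msupp g : seq word)).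
Proof.
apply: (iffP allP) => [h w wd|h w].
  by apply/eqP; rewrite mcoeff_eq0; apply: contra wd => /h.
by rewrite -mcoeff_neq0; apply: contraR => /h ->.
Qed.

Lemma homog_restrict d g : homog d (restrict_words (fun w => thdeg w == d) g).
Proof. by move=> w /negPf wd; rewrite restrict_wordsE wd. Qed.

Lemma homogM d e g h : homog d g -> homog e h -> homog (d + e) (g * h).
Proof.
move=> /homogP/allP gd /homogP/allP he; apply/homogP/allP => w.
move=> /msuppM_le [u [v [ug vh ->]]].
by rewrite thdegM (eqP (gd _ ug)) (eqP (he _ vh)).
Qed.

Lemma F_evenP a : F_even a <-> exists2 g, homog 0 g & a = cls g.
Proof. by split=> -[g /homogP h ->]; exists g. Qed.

Lemma F_oddP a : F_odd a <-> exists2 g, homog 1 g & a = cls g.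
Proof. by split=> -[g /homogP h ->]; exists g. Qed.

Lemma even_part_even a : F_even (even_part a).
Proof. by apply/F_evenP; eexists; last reflexivity; apply: homog_restrict. Qed.

Lemma even_part_odd a : F_odd (a - even_part a).
Proof.
elim/FA2_ind: a => g; apply/F_oddP; rewrite even_part_cls -clsN -clsD.
exists (restrict_words (fun w => thdeg w == 1%N) g); first exact: homog_restrict.
apply/clsP/theta_idealP => w; rewrite !(mcoeffB, restrict_wordsE).
by case: (thdeg w) => [|[|]] //= _; rewrite ?subr0 ?subrr.
Qed.

Lemma even_partD a0 a1 : F_even a0 -> F_odd a1 -> even_part (a0 + a1) = a0.
Proof.
move=> /F_evenP [g g0 ->] /F_oddP [h h1 ->]; rewrite -clsD even_part_cls.
apply/clsP/theta_idealP => w _; rewrite mcoeffB restrict_wordsE mcoeffD.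
by case: eqP => [w0|/eqP w0]; [rewrite h1 ?w0 // addr0 subrr | rewrite g0 // subrr].
Qed.

Lemma FA2_z2_algebra : z2_algebra F_even F_odd.
Proof.
have homogL d c g h : homog d g -> homog d h -> homog d (c *: g + h).
  by move=> gd hd w wd; rewrite mcoeffD mcoeffZ gd // hd // mulr0 addr0.
have homog0 d : homog d 0 by move=> w _; rewrite mcoeff0.
split.
- split; split.
  + by apply/F_evenP; exists 0; rewrite ?cls0.
  + move=> c a b /F_evenP [g g0 ->] /F_evenP [h h0 ->]; apply/F_evenP.
    by exists (c *: g + h); [apply: homogL | rewrite clsD clsZ].
  + by apply/F_oddP; exists 0; rewrite ?cls0.
  + move=> c a b /F_oddP [g g0 ->] /F_oddP [h h0 ->]; apply/F_oddP.
    by exists (c *: g + h); [apply: homogL | rewrite clsD clsZ].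
- move=> a; exists (even_part a, a - even_part a); split=> /=.
    by split; [apply: even_part_even|apply: even_part_odd|rewrite addrC subrK].
  by move=> [b0 b1] /= [h0 h1 ->]; rewrite even_partD // addrC addKr.
- move=> a b /F_evenP [g g0 ->] /F_evenP [h h0 ->]; apply/F_evenP.
  by exists (g * h); [apply: (homogM g0 h0) | rewrite clsM].
- move=> a b /F_evenP [g g0 ->] /F_oddP [h h1 ->]; split; apply/F_oddP.
    by exists (g * h); [apply: (homogM g0 h1) | rewrite clsM].
  by exists (h * g); [apply: (homogM h1 g0) | rewrite clsM].
- move=> a b /F_oddP [g g1 ->] /F_oddP [h h1 ->].
  rewrite -clsM -cls0; apply/clsP/theta_idealP => w w2.
  rewrite subr0 (homogM g1 h1) //.
  by apply: contraTneq w2 => ->.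
Qed.

Definition revw (w : word) : word := FMonom (rev w).

Definition reverse_words (g : free_alg) : free_alg :=
  \sum_(w <- msupp g) << g@_w *g revw w >>.

Lemma revwK : involutive revw.
Proof. by move=> w; apply/eqP; rewrite fmP /= revK. Qed.

Lemma thdeg_revw w : thdeg (revw w) = thdeg w.
Proof. by rewrite /thdeg count_rev. Qed.

Lemma reverse_wordsE g w : (reverse_words g)@_w = g@_(revw w).
Proof.
rewrite {2}(monalgE g) !raddf_sum; apply: eq_bigr => u _ /=.
by rewrite !mcoeffU (can2_eq revwK revwK).
Qed.

Definition star (a : FA2) : FA2 := cls (reverse_words (repr a)).

Lemma star_cls g : star (cls g) = cls (reverse_words g).
Proof.
apply/clsP/theta_idealP => w w2; rewrite mcoeffB !reverse_wordsE -mcoeffB.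
by apply: (theta_idealP _ (repr_cls g)); rewrite thdeg_revw.
Qed.

Lemma prod_gen (s : seq letter) : \prod_(y <- s) gen y = cls << FMonom s >>.
Proof.
elim: s => [|y s IHs]; first by rewrite big_nil -fmoneE.
rewrite big_cons IHs /gen -clsM; congr cls.
rewrite malgM_def fgmulUU mulr1; congr << _ >>.
by apply/eqP; rewrite fmP fmM fmU.
Qed.

Lemma star_prod_gen (s : seq letter) :
  star (\prod_(y <- s) gen y) = \prod_(y <- rev s) gen y.
Proof.
rewrite !prod_gen star_cls; congr cls; apply/malgP => w.
rewrite reverse_wordsE !mcoeffU -[FMonom (rev s)]/(revw (FMonom s)).
by rewrite (can2_eq revwK revwK).
Qed.

Lemma star_linear : linear star.
Proof.
move=> c; elim/FA2_ind=> g; elim/FA2_ind=> h.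
rewrite -clsZ -clsD !star_cls -clsZ -clsD; congr cls; apply/malgP => w.
by rewrite reverse_wordsE !mcoeffD !mcoeffZ !reverse_wordsE.
Qed.

Definition bullet (a b : FA2) : FA2 :=
  2%:R^-1 *: (a * even_part b + even_part b * a).

Definition reversible : set FA2 := [set a | star a = a].

Definition brace (s : seq letter) : FA2 :=
  2%:R^-1 *: (\prod_(y <- s) gen y + \prod_(y <- rev s) gen y).

Section Tetrads.
Variable le : rel letter.
Local Notation "x ≺ y" := (strict le x y) (at level 70).

Definition even_tetrad : set FA2 :=
  fun a => exists x1 x2 x3 x4 : X,
    [/\ inl x1 ≺ inl x2, inl x2 ≺ inl x3, inl x3 ≺ inl x4
      & a = brace [:: inl x1; inl x2; inl x3; inl x4]].

Definition odd_tetrad : set FA2 :=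
  fun a => exists (t : Theta) (x1 x2 x3 : X),
    [/\ inl x1 ≺ inl x2, inl x2 ≺ inl x3
      & a = brace [:: inr t; inl x1; inl x2; inl x3]].

Definition generators : set FA2 :=
  fun a => [\/ a = 1, exists y, a = gen y, even_tetrad a | odd_tetrad a].

End Tetrads.

End FreeZ2Algebra.

(* Main.v *)
(* Every reversible element is a combination of braces of words, so it suffices
   to show that all braces lie in the subalgebra H' generated by 1, the letters
   and the tetrads.  A bullet product of braces of u and v gives the relation
     {uv} + {uv*} + {u*v} + {vu} = 0  modulo H'
   once {u} and {v} are in H', which allows induction on the length n.
   With u a letter, {xv} = -{vx}: rotating n times disposes of odd n.  With u of
   length 2 and n even, {xyv} = -{yxv}, so the brace is alternating in its
   letters.  If n = 2 mod 4, reversal is an odd permutation, and the brace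
   vanishes.  If n = 4, sorting the letters yields a tetrad, a repetition, or a
   word with two letters in Theta.  If n = 0 mod 4 and n >= 8, taking u of length
   4 makes the four terms of the relation equal. *)
Require Import Defs.
From HB Require Import structures.
From mathcomp Require Import all_boot all_order all_algebra.
From mathcomp Require Import finmap monalg.
From mathcomp Require Import classical_sets.

Set Implicit Arguments.
Unset Strict Implicit.
Unset Printing Implicit Defensive.

Import GRing.Theory.
Local Open Scope ring_scope.

(** Reversing a word of length 2m takes ['C(m.*2, 2)] adjacent swaps, so the sign of the reversal is
    the parity of m. *)
Lemma odd_bin2_double m : odd 'C(m.*2, 2) = odd m.
Proof. by case: m => // m; rewrite bin2 -doubleMl doubleK oddM /= odd_double andbT. Qed.

(** * Closure properties of subspaces *)

Section Subspace.
Variables (k : fieldType) (V : lmodType k) (H : set V).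
Hypothesis H_sub : subspace H.

Lemma subspace0 : H 0.
Proof. by case: H_sub. Qed.

Lemma subspaceZ c u : H u -> H (c *: u).
Proof. by case: H_sub => H0 HL Hu; rewrite -[_ *: _]addr0; apply: HL. Qed.

Lemma subspaceD u v : H u -> H v -> H (u + v).
Proof. by case: H_sub => _ HL Hu Hv; rewrite -[u]scale1r; apply: HL. Qed.

Lemma subspaceZ_inv c u : c != 0 -> H (c *: u) -> H u.
Proof. by move=> c0 /(subspaceZ c^-1); rewrite scalerA mulVf ?scale1r. Qed.

End Subspace.

(** * Braces of words, as an abstract map [f], modulo the subspace [H] *)

Section ReversibleWords.
Variables (k : fieldType) (V : lmodType k) (H : set V).
Variables (T : eqType) (le : rel T) (f : seq T -> V).
Hypothesis two_neq0 : 2%:R != 0 :> k.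
Hypothesis H_sub : subspace H.
Hypothesis le_order : total_order le.
Hypothesis f_rev : forall w, f (rev w) = f w.
Hypothesis f_jordan : forall u v, H (f u) -> H (f v) ->
  H (f (u ++ v) + f (u ++ rev v) + f (rev u ++ v) + f (v ++ u)).
Hypothesis f_nil : H (f [::]).
Hypothesis f_letter : forall x, H (f [:: x]).
Hypothesis f_tetrad : forall x1 x2 x3 x4,
  strict le x1 x2 -> strict le x2 x3 -> strict le x3 x4 ->
  H (f [:: x1; x2; x3; x4]).

(** Congruence up to sign modulo [H]; the sign is a boolean, [true] for minus, since the signs below
    arise as parities. *)
Let signed_eq (b : bool) (u v : seq T) : Prop := H (f u - (-1) ^+ b *: f v).

Let signed_eq_refl u : signed_eq false u u.
Proof. by rewrite /signed_eq expr0 scale1r subrr; apply: subspace0. Qed.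

Let signed_eq_trans b c u v w :
  signed_eq b u v -> signed_eq c v w -> signed_eq (b (+) c) u w.
Proof.
rewrite /signed_eq => Huv /(subspaceZ H_sub ((-1) ^+ b)) /(subspaceD H_sub Huv).
by rewrite scalerBr addrA subrK scalerA signr_addb.
Qed.

Let signed_eq_sym b u v : signed_eq b u v -> signed_eq b v u.
Proof.
rewrite /signed_eq => /(subspaceZ H_sub (- (-1) ^+ b)).
by rewrite scalerBr !scaleNr opprK scalerA -signr_addb addbb scale1r addrC.
Qed.

Let signed_eq_mem b u v : signed_eq b u v -> H (f v) -> H (f u).
Proof.
move=> Huv Hv; rewrite -[f u](subrK ((-1) ^+ b *: f v)).
by apply: (subspaceD H_sub) => //; apply: (subspaceZ H_sub).
Qed.

Let mem_double a : H (a + a) -> H a.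
Proof. by rewrite -mulr2n -scaler_nat; apply: (subspaceZ_inv H_sub). Qed.

Let signed_eq_subst a u v : signed_eq false u v -> H (a + f v) -> H (a + f u).
Proof.
rewrite /signed_eq scale1r => Huv Ha; have := subspaceD H_sub Ha Huv.
by rewrite -addrA [f v + _]addrC subrK.
Qed.

Let signed_eq_opp u : signed_eq true u u -> H (f u).
Proof. by rewrite /signed_eq expr1 scaleN1r opprK; apply: mem_double. Qed.

(** * Signed rotations and transpositions of words of length [n] *)

Section FixedLength.
Variable n : nat.
Hypothesis shorter : forall w, (size w < n)%N -> H (f w).

(** A single letter x is its own reversal and {xv*} = {vx}, so the relation for u = x reads 2({xv} +
    {vx}). *)
Let rotate_head x v : size (x :: v) = n -> signed_eq true (x :: v) (rcons v x).
Proof.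
rewrite /signed_eq expr1 scaleN1r opprK; case: v => [|y v] sz.
  by apply: (subspaceD H_sub); apply: f_letter.
have Hv : H (f (y :: v)) by apply: shorter; rewrite -sz.
set w := y :: v in Hv *; have := f_jordan (f_letter x) Hv.
rewrite -[f ([:: x] ++ rev w)]f_rev rev_cat revK !cats1 => Hf.
by apply: mem_double; rewrite addrA.
Qed.

Let rotate i w : size w = n -> (i <= n)%N -> signed_eq (odd i) w (rot i w).
Proof.
elim: i => [|i IHi] sz lin; first by rewrite rot0; apply: signed_eq_refl.
rewrite rotS ?sz //= -addbT; apply: signed_eq_trans (IHi sz (ltnW lin)) _.
have: size (rot i w) = n by rewrite size_rot.
case: (rot i w) => [|x v] szr; last by rewrite rot1_cons; apply: rotate_head.
by rewrite -szr in lin.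
Qed.

Let rotate_cat u v : size (u ++ v) = n -> signed_eq (odd (size u)) (u ++ v) (v ++ u).
Proof.
move=> sz; rewrite -(rot_size_cat u v); apply: rotate => //.
by rewrite -sz size_cat leq_addr.
Qed.

Lemma odd_length_mem w : odd n -> size w = n -> H (f w).
Proof.
move=> on sz; apply: signed_eq_opp; rewrite -on -{2}(rot_size w) sz.
exact: rotate.
Qed.

Hypothesis even_n : ~~ odd n.

(** Here {xyw*} = {wyx}, and rotating by two letters costs no sign, so the relation for u = xy
    becomes 2({xyw} + {yxw}). *)
Let swap_head x y v : size (x :: y :: v) = n ->
  signed_eq true (x :: y :: v) (y :: x :: v).
Proof.
(* For n = 2 the pair xy has full length, out of reach of [shorter], but the swap is then a
   rotation. *)
case: v => [|z v] sz; first exact: rotate_head sz.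
set w := z :: v in sz *.
have Hxy : H (f [:: x; y]) by apply: shorter; rewrite -sz.
have Hw : H (f w) by apply: shorter; rewrite -sz /=.
have Hf : H (f (x :: y :: w) + f (w ++ [:: y; x]) + f (y :: x :: w) + f (w ++ [:: x; y])).
  by have := f_jordan Hxy Hw; rewrite -[f (_ ++ rev w)]f_rev rev_cat revK.
have {Hf} := signed_eq_subst (@rotate_cat [:: x; y] w sz) Hf.
have Hyx := @rotate_cat [:: y; x] w sz.
rewrite addrAC [_ + f (w ++ _) + _]addrAC addrAC => /(signed_eq_subst Hyx).
rewrite -(addrA (_ + _)) addrACA => /mem_double.
by rewrite /signed_eq expr1 scaleN1r opprK.
Qed.

(** Rotate [p] to the end, swap at the head, rotate back: both rotations have the parity of
    [size p], so their signs cancel. *)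
Let swap p x y s : size (p ++ x :: y :: s) = n ->
  signed_eq true (p ++ x :: y :: s) (p ++ y :: x :: s).
Proof.
move=> sz; have sw : signed_eq true (x :: y :: s ++ p) (y :: x :: s ++ p).
  by apply: swap_head; rewrite -sz !size_cat /= addnC size_cat.
rewrite -[true](addKb (odd (size p))) addbC -addbA.
apply: signed_eq_trans (rotate_cat sz) _.
by apply: signed_eq_trans sw _; apply/signed_eq_sym/rotate_cat; rewrite -sz !size_cat.
Qed.

Let move_letter p x v s : size (p ++ x :: v ++ s) = n ->
  signed_eq (odd (size v)) (p ++ x :: v ++ s) (p ++ v ++ x :: s).
Proof.
elim: v p => [|y v IHv] p sz; first exact: signed_eq_refl.
rewrite -[odd _]/(~~ odd (size v)) -addTb; apply: signed_eq_trans (swap sz) _.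
rewrite -[p ++ y :: x :: _]cat_rcons -[p ++ (y :: v) ++ _]cat_rcons; apply: IHv.
by rewrite cat_rcons -sz !size_cat.
Qed.

Let reverse_factor p v s : size (p ++ v ++ s) = n ->
  signed_eq (odd 'C(size v, 2)) (p ++ v ++ s) (p ++ rev v ++ s).
Proof.
elim: v p => [|x v IHv] p sz; first exact: signed_eq_refl.
(* Pascal's rule splits the count of swaps: reverse the tail [v], then carry [x] past its [size v]
   letters. *)
rewrite [size _]/= binS bin1 oddD rev_cons cat_rcons.
rewrite -[p ++ _ ++ s]cat_rcons in sz *.
apply: signed_eq_trans (IHv _ sz) _; rewrite cat_rcons -(size_rev v).
by apply: move_letter; rewrite -sz cat_rcons !size_cat /= !size_cat size_rev.
Qed.

(** Membership in [H] ignores signs, so letters may be reordered one at a time: the head of [s] is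
    pulled to the front of [t]. *)
Let mem_perm s t p : perm_eq s t -> size (p ++ s) = n -> H (f (p ++ t)) -> H (f (p ++ s)).
Proof.
elim: s t p => [|x s IHs] t p; first by rewrite perm_sym => /perm_nilP ->.
move=> pst sz Ht; have xt : x \in t by rewrite -(perm_mem pst) mem_head.
case/splitPr: xt pst Ht => t1 t2 pst Ht.
have {}pst: perm_eq s (t1 ++ t2).
  by rewrite -(perm_cons x) (permPl pst) -cat1s perm_catCA.
have szt: size (p ++ x :: t1 ++ t2) = n by rewrite -sz !size_cat /= (perm_size pst) size_cat.
rewrite -cat_rcons; apply: (IHs (t1 ++ t2)); rewrite ?cat_rcons //.
exact: signed_eq_mem (move_letter szt) Ht.
Qed.

Let mem_size4 w : n = 4 -> size w = n -> H (f w).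
Proof.
move=> n4 sz; have [_ le_anti le_trans le_total] := le_order.
have pw : perm_eq w (sort le w) by rewrite perm_sym perm_sort.
apply: (@mem_perm _ _ [::] pw) => //=.
have szs : size (sort le w) = 4 by rewrite size_sort sz.
have := sort_sorted le_total w; move: (sort le w) szs.
case=> [|a [|b [|c [|d []]]]] //= _ /and4P [ab bc cd _].
(* Swapping two equal neighbours changes only the sign, so such a word is its own negative modulo
   [H]. *)
have [eab|nab] := eqVneq a b.
  by have := @swap [::] a b [:: c; d]; rewrite n4 eab => /(_ erefl) /signed_eq_opp.
have [ebc|nbc] := eqVneq b c.
  by have := @swap [:: a] b c [:: d]; rewrite n4 ebc => /(_ erefl) /signed_eq_opp.
have [ecd|ncd] := eqVneq c d.
  by have := @swap [:: a; b] c d [::]; rewrite n4 ecd => /(_ erefl) /signed_eq_opp.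
by apply: f_tetrad; rewrite /strict ?nab ?nbc ?ncd.
Qed.

Lemma even_length_mem w : size w = n -> H (f w).
Proof.
move=> sz; have [m def_n] : exists m, n = m.*2.
  by exists n./2; rewrite -[LHS]odd_double_half (negPf even_n).
(* For odd m the reversal carries a minus sign, while [f_rev] says that [f] does not see it. *)
have [om|em] := boolP (odd m).
  have := @reverse_factor [::] w [::]; rewrite /= !cats0 => /(_ sz).
  by rewrite sz def_n odd_bin2_double om /signed_eq f_rev => /signed_eq_opp.
have [q def_m] : exists q, m = q.*2.
  by exists m./2; rewrite -[LHS]odd_double_half (negPf em).
case: q => [|[|q]] in def_m; rewrite def_m in def_n.
- by rewrite def_n in sz; rewrite (size0nil sz).
- exact: mem_size4.
(* Now n is a multiple of 4 and at least 8, so [u] and [v] are shorter than [w] and have lengths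
   divisible by 4: reversing either, or exchanging them, costs no sign. *)
rewrite -(cat_take_drop 4 w); set u := take 4 w; set v := drop 4 w.
have szu : size u = 4 by rewrite size_takel // sz def_n.
have szv : size v = q.+1.*2.*2 by rewrite size_drop sz def_n !doubleS !subSS subn0.
have szuv : size (u ++ v) = n by rewrite cat_take_drop.
have Hu : H (f u) by apply: shorter; rewrite szu def_n.
have Hv : H (f v) by apply: shorter; rewrite szv def_n !ltn_double.
have := f_jordan Hu Hv.
have := rotate_cat szuv; have := @reverse_factor [::] u v.
have := @reverse_factor u v [::].
rewrite /= !cats0 szu szv odd_bin2_double odd_double.
move=> /(_ szuv) Hv' /(_ szuv) Hu' Hrot Hf.
(* The relation turns into four copies of [f (u ++ v)], to be halved twice. *)
have {Hf} := signed_eq_subst Hrot Hf; rewrite addrAC => /(signed_eq_subst Hu').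
rewrite [_ + f (u ++ rev v) + _]addrAC [X in H X -> _]addrAC => /(signed_eq_subst Hv').
by rewrite -(addrA (_ + _)) => /mem_double /mem_double.
Qed.

End FixedLength.

Lemma reversible_words_mem w : H (f w).
Proof.
have [n] := ubnP (size w); elim: n w => // n IHn w; rewrite ltnS => lwn.
have shorter v : (size v < size w)%N -> H (f v).
  by move=> lvw; apply: IHn; apply: leq_trans lvw lwn.
have [ow|ew] := boolP (odd (size w)); first exact: odd_length_mem ow erefl.
exact: even_length_mem ew _ erefl.
Qed.

End ReversibleWords.

(** * The Jordan product of an associative algebra *)

Section JordanProduct.
Variables (k : fieldType) (A : algType k).
Hypothesis two_neq0 : 2%:R != 0 :> k.
Implicit Types a b x y p q r : A.

Definition jordan a b : A := 2%:R^-1 *: (a * b + b * a).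

Lemma jordanC a b : jordan a b = jordan b a.
Proof. by rewrite /jordan addrC. Qed.

Lemma jordan_linearr a : linear (jordan a).
Proof.
move=> c u v; rewrite /jordan mulrDr mulrDl -scalerAr -scalerAl addrACA -(scalerDr c).
by rewrite [LHS]scalerDr !scalerA [_ * c]mulrC.
Qed.

Lemma jordan_linearl b : linear (jordan^~ b).
Proof. by move=> c u v; rewrite jordanC jordan_linearr !(jordanC b). Qed.

Lemma jordanxx p : jordan p p = p * p.
Proof. by rewrite /jordan -mulr2n -scaler_nat scalerA mulVf ?scale1r. Qed.

Lemma jordan_jordanr a b r :
  jordan a (jordan b r) = (2%:R^-1 * 2%:R^-1) *: (a * (b * r + r * b) + (b * r + r * b) * a).
Proof. by rewrite /jordan -scalerAl -scalerAr -scalerDr scalerA. Qed.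

(** Left multiplications always commute with right ones, and those on the same side commute because
    [q] and [r] do. *)
Lemma jordan_commuting x q r :
  q * r = r * q -> jordan (jordan x q) r = jordan (jordan x r) q.
Proof.
move=> qr; rewrite ![jordan (jordan _ _) _]jordanC !jordan_jordanr; congr (_ *: _).
rewrite !mulrDr !mulrDl !mulrA -!(mulrA x) qr -(mulrA r) -(mulrA q).
by rewrite [LHS](AC (2*2) ((4*2)*(3*1))).
Qed.

(* Both sides of the third generalized Jordan axiom are instances of this
   associator formula. *)
Lemma jordan_associator x q r :
  jordan x (jordan q r) - jordan (jordan x q) r =
  (2%:R^-1 * 2%:R^-1) *: ((x * r - r * x) * q - q * (x * r - r * x)).
Proof.
rewrite [jordan (jordan x q) r]jordanC !jordan_jordanr -scalerBr; congr (_ *: _).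
rewrite !mulrDr !mulrDl !mulrN !mulNr !mulrA.
rewrite [X in X - _](AC (2*2) ((2*3)*(1*4))) [X in _ - X](AC (2*2) ((1*4)*(3*2))).
by rewrite opprD addrACA subrr addr0 opprD addrACA opprB.
Qed.

End JordanProduct.

(** * Elementary consequences of linearity *)

Section LinearMaps.
Variables (k : fieldType) (U V W : lmodType k).

Lemma linear_map0 (f : U -> V) : linear f -> f 0 = 0.
Proof. by move=> /(_ (-1) 0 0); rewrite scaler0 addr0 scaleN1r addNr. Qed.

Lemma linear_mapD (f : U -> V) : linear f -> {morph f : a b / a + b}.
Proof. by move=> f_lin a b; have := f_lin 1 a b; rewrite !scale1r. Qed.

Lemma linear_mapZ (f : U -> V) : linear f -> forall c, {morph f : a / c *: a}.
Proof. by move=> f_lin c a; have := f_lin c a 0; rewrite (linear_map0 f_lin) !addr0. Qed.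

Lemma linear_comp (f : V -> W) (g : U -> V) :
  linear f -> linear g -> linear (fun a => f (g a)).
Proof. by move=> f_lin g_lin c u v; rewrite g_lin f_lin. Qed.

End LinearMaps.

Lemma mul_linearl (k : fieldType) (A : algType k) (b : A) : linear (fun a => a * b).
Proof. by move=> c u v; rewrite mulrDl scalerAl. Qed.

Lemma mul_linearr (k : fieldType) (A : algType k) (a : A) : linear (fun b => a * b).
Proof. by move=> c u v; rewrite mulrDr scalerAr. Qed.

(* [A] abstracts [FA2], of which only these properties of the words and of the
   induced even part and reversal are used. *)
Section WordAlgebra.
Variables (k : fieldType) (A : algType k) (T : eqType) (theta : pred T).
Variables (monom : seq T -> A) (even star : A -> A).
Hypothesis two_neq0 : 2%:R != 0 :> k.
Hypothesis monom_span : forall P : set A,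
  subspace P -> (forall s, P (monom s)) -> forall a, P a.
Hypothesis monom_nil : monom [::] = 1.
Hypothesis monom_cat : forall s t, monom (s ++ t) = monom s * monom t.
Hypothesis monom_eq0 : forall s, (1 < count theta s)%N -> monom s = 0.
Hypothesis even_linear : linear even.
Hypothesis even_monom : forall s,
  even (monom s) = if count theta s == 0%N then monom s else 0.
Hypothesis star_linear : linear star.
Hypothesis star_monom : forall s, star (monom s) = monom (rev s).

Let bullet (a b : A) : A := 2%:R^-1 *: (a * even b + even b * a).
Let brace (s : seq T) : A := 2%:R^-1 *: (monom s + monom (rev s)).
Let reversible : set A := [set a | star a = a]%classic.

Lemma linear_ext (V : lmodType k) (f g : A -> V) :
  linear f -> linear g -> (forall s, f (monom s) = g (monom s)) -> f =1 g.
Proof.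
move=> f_lin g_lin fg a; apply: (monom_span (P := fun a => f a = g a)) => //.
split=> [|c u v fgu fgv]; first by rewrite (linear_map0 f_lin) (linear_map0 g_lin).
by rewrite f_lin g_lin fgu fgv.
Qed.

(** Counts of [theta] letters add under concatenation, so a product of words is even exactly when
    both factors are. *)
Lemma evenM a b : even (a * b) = even a * even b.
Proof.
move: a; apply: linear_ext => [||s].
- exact: linear_comp even_linear (mul_linearl b).
- exact: linear_comp (mul_linearl _) even_linear.
move: b; apply: linear_ext => [||t].
- exact: linear_comp even_linear (mul_linearr _).
- exact: linear_comp (mul_linearr _) even_linear.
rewrite -monom_cat !even_monom count_cat addn_eq0 monom_cat.
by case: eqP; case: eqP; rewrite ?mul0r ?mulr0.
Qed.

Lemma even_id a : even (even a) = even a.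
Proof.
move: a; apply: linear_ext => [||s] //; first exact: linear_comp.
rewrite even_monom; case: ifP => [s0|_]; first by rewrite even_monom s0.
exact: linear_map0.
Qed.

Lemma starM a b : star (a * b) = star b * star a.
Proof.
move: a; apply: linear_ext => [||s].
- exact: linear_comp star_linear (mul_linearl b).
- exact: linear_comp (mul_linearr _) star_linear.
move: b; apply: linear_ext => [||t].
- exact: linear_comp star_linear (mul_linearr _).
- exact: linear_comp (mul_linearl _) star_linear.
by rewrite -monom_cat !star_monom rev_cat monom_cat.
Qed.

Lemma even_star a : even (star a) = star (even a).
Proof.
move: a; apply: linear_ext => [||s]; [exact: linear_comp | exact: linear_comp |].
rewrite star_monom !even_monom count_rev.
by case: ifP; rewrite ?star_monom // (linear_map0 star_linear).
Qed.

(** Reduces identities for the bullet to identities for the symmetric Jordan product. *)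
Lemma bulletE a b : bullet a b = jordan a (even b).
Proof. by []. Qed.

Lemma star_jordan a b : star (jordan a b) = jordan (star a) (star b).
Proof. by rewrite /jordan linear_mapZ // linear_mapD // !starM addrC. Qed.

Lemma even_jordan a b : even (jordan a b) = jordan (even a) (even b).
Proof. by rewrite /jordan linear_mapZ // linear_mapD // !evenM. Qed.

Lemma even_brace s : even (brace s) = if count theta s == 0%N then brace s else 0.
Proof.
rewrite /brace linear_mapZ // linear_mapD // !even_monom count_rev.
by case: ifP; rewrite ?addr0 ?scaler0.
Qed.

Lemma brace_rev s : brace (rev s) = brace s.
Proof. by rewrite /brace revK addrC. Qed.

Lemma brace_eq0 s : (1 < count theta s)%N -> brace s = 0.
Proof. by move=> s2; rewrite /brace !monom_eq0 ?count_rev // addr0 scaler0. Qed.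

Lemma brace_reversible s : reversible (brace s).
Proof.
by rewrite /reversible /= /brace linear_mapZ // linear_mapD // !star_monom revK addrC.
Qed.

Lemma brace_palindrome s : rev s = s -> brace s = monom s.
Proof.
by move=> rs; rewrite /brace rs -mulr2n -scaler_nat scalerA mulVf ?scale1r.
Qed.

Lemma bullet_gj_algebra : gj_algebra bullet.
Proof.
have even_sqr a : even (jordan a (even a)) = even a * even a.
  by rewrite even_jordan even_id jordanxx.
split.
- split=> [y|x]; first exact: jordan_linearl.
  exact: linear_comp (jordan_linearr x) even_linear.
- move=> x y z; rewrite !bulletE !even_jordan !even_id.
  by rewrite [jordan (even y) _]jordanC.
- by move=> x y; rewrite !bulletE even_sqr; apply: jordan_commuting; rewrite mulrA.
move=> x y; rewrite !bulletE !even_jordan !even_id jordanxx //.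
rewrite jordan_associator -scalerBr jordan_associator.
set p := even x; set q := even y.
(* The two associators start with [x] and [jordan x p] and end with [p * p] and [p]. This commutator
   identity matches them, its factor 1/2 cancelling the 2 of the axiom. *)
have -> : jordan x p * p - p * jordan x p = 2%:R^-1 *: (x * (p * p) - p * p * x).
  rewrite /jordan -scalerAl -scalerAr -scalerBr; congr (_ *: _).
  by rewrite mulrDl mulrDr !mulrA opprD addrA addrK.
rewrite -scalerAl -scalerAr -scalerBr !scalerA; congr (_ *: _).
by rewrite mulVKf.
Qed.

(** Reversal turns products around, which the symmetric Jordan product does not see, and it commutes
    with [even]. *)
Lemma reversible_gj_subalgebra : gj_subalgebra bullet reversible.
Proof.
split=> [|x y]; last by rewrite /reversible /= bulletE star_jordan -even_star => -> ->.
split; first exact: linear_map0.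
by move=> c u v; rewrite /reversible /= star_linear => -> ->.
Qed.

Lemma reversible_gj_right_unital : gj_right_unital bullet reversible.
Proof.
exists 1; first by rewrite /reversible /= -monom_nil star_monom.
move=> x _; rewrite /bullet -monom_nil even_monom /= monom_nil mulr1 mul1r.
by rewrite -mulr2n -scaler_nat scalerA mulVf ?scale1r.
Qed.

(** Multiplying out the two braces gives eight words, which pair with their reversals into the four
    braces on the left. *)
Lemma jordan_brace u v :
  brace (u ++ v) + brace (u ++ rev v) + brace (rev u ++ v) + brace (v ++ u)
  = (2%:R * 2%:R) *: jordan (brace u) (brace v).
Proof.
rewrite /jordan /brace !rev_cat !revK !monom_cat -!scalerDr.
rewrite -!scalerAl -!scalerAr !scalerA -scalerDr scalerA.
congr (_ *: _); first by rewrite mulfK // mulVKf.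
rewrite !mulrDl !mulrDr.
by rewrite [LHS](AC (2*2*2*2) (((1*3)*(5*8))*((7*4)*(6*2)))).
Qed.

(** * Reversible elements and the generated subalgebra *)

Section Generated.
Variables (le : rel T) (G : set A).
Hypothesis le_order : total_order le.
Hypothesis G_reversible : forall a, G a -> reversible a.
Hypothesis G_one : G 1.
Hypothesis G_letter : forall y, G (monom [:: y]).
Hypothesis G_tetrad : forall x1 x2 x3 x4,
  strict le x1 x2 -> strict le x2 x3 -> strict le x3 x4 ->
  (count theta [:: x1; x2; x3; x4] <= 1)%N -> G (brace [:: x1; x2; x3; x4]).

Let H : set A := gj_generated bullet G.

Let H_sub : subspace H.
Proof. by case: (gj_generated_subalgebra bullet G). Qed.

Let H_gen a : G a -> H a.
Proof. by move=> Ga P [_]; apply. Qed.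

(** The bullet sees only the even part of its second factor, so a word without [theta] letters is
    put second. If both words have some, each brace in [jordan_brace] contains at least two and
    vanishes. *)
Lemma generated_jordan_brace u v :
  H (brace u) -> H (brace v) -> H (jordan (brace u) (brace v)).
Proof.
have [_ H_mul] := gj_generated_subalgebra bullet G.
move=> Hu Hv; have [v0|v1] := eqVneq (count theta v) 0%N.
  by have := H_mul _ _ Hu Hv; rewrite bulletE even_brace v0.
have [u0|u1] := eqVneq (count theta u) 0%N.
  by have := H_mul _ _ Hv Hu; rewrite bulletE even_brace u0 jordanC.
apply: (subspaceZ_inv H_sub (mulf_neq0 two_neq0 two_neq0)); rewrite -jordan_brace.
have uv : (1 < count theta u + count theta v)%N.
  by rewrite -[1%N]/(0 + 1)%N -addSn leq_add ?lt0n.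
rewrite !brace_eq0 ?addr0; first exact: subspace0.
all: by rewrite count_cat ?count_rev // addnC.
Qed.

Lemma generated_brace s : H (brace s).
Proof.
apply: (reversible_words_mem two_neq0 H_sub le_order) => [w|u v Hu Hv||y|a b c d ab bc cd].
- exact: brace_rev.
- rewrite jordan_brace; apply: (subspaceZ H_sub); exact: generated_jordan_brace.
- by rewrite brace_palindrome // monom_nil; apply: H_gen.
- by rewrite brace_palindrome //; apply: H_gen.
(* An increasing quadruple with two [theta] letters is not covered by [G_tetrad], but its brace is
   zero. *)
have [le1|gt1] := leqP (count theta [:: a; b; c; d]) 1; first by apply: H_gen; apply: G_tetrad.
by rewrite brace_eq0 //; apply: subspace0.
Qed.

Lemma reversible_generated : reversible = H.
Proof.
apply/seteqP; split=> [a rev_a|]; last first.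
  exact: smallest_sub reversible_gj_subalgebra G_reversible.
(* Symmetrization sends words to braces, hence by linearity everything into [H]; it fixes the
   reversible elements. *)
have sym b : H (2%:R^-1 *: (b + star b)).
  move: b; apply: monom_span => [|s]; last by rewrite star_monom; apply: generated_brace.
  split=> [|c u v Hu Hv].
    by rewrite (linear_map0 star_linear) addr0 scaler0; apply: subspace0.
  rewrite star_linear addrACA -(scalerDr c) [X in H X]scalerDr scalerA mulrC -scalerA.
  by case: H_sub => _; apply.
have := sym a; rewrite (rev_a : star a = a) -mulr2n -scaler_nat.
by rewrite scalerA mulVf ?scale1r.
Qed.

End Generated.
End WordAlgebra.

Lemma malgUE (K : choiceType) (R : nzRingType) (c : R) (w : K) :
  << c *g w >> = c *: << w >> :> {malg R[K]}.
Proof. by apply/malgP => v; rewrite mcoeffZ !mcoeffU mulrnAr mulr1. Qed.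

(** * Words in the free algebra *)

Section FreeZ2Words.
Variables (k : fieldType) (X Theta : choiceType).
Local Notation F := (FA2 k X Theta).
Local Notation monom s := (\prod_(y <- s) gen k y : F).
Local Notation thetas s := (count (@is_theta X Theta) s).

Lemma FA2_linear_ind (P : set F) :
  subspace P -> (forall s, P (monom s)) -> forall a, P a.
Proof.
move=> P_sub Pw; elim/FA2_ind => g; rewrite (monalgE g).
elim/big_rec: _ => [|w h _ Ph]; first by rewrite cls0; apply: subspace0 P_sub.
rewrite clsD; apply: subspaceD => //; rewrite malgUE.
rewrite clsZ; apply: subspaceZ => //; case: (w) => s.
by have := Pw s; rewrite prod_gen.
Qed.

Lemma monom_eq0 s : (1 < thetas s)%N -> monom s = 0.
Proof.
rewrite prod_gen -cls0 => s2; apply/clsP/theta_idealP => w; rewrite subr0 mcoeffU.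
by case: eqP => // <-; rewrite ltnNge s2.
Qed.

Lemma even_part_monom s :
  even_part (monom s) = if thetas s == 0%N then monom s else 0.
Proof.
rewrite prod_gen even_part_cls -cls0 -(fun_if (@cls k X Theta)); congr cls.
apply/malgP => w; rewrite restrict_wordsE mcoeffU (fun_if (mcoeff w)) mcoeffU mcoeff0.
by have [<-|_] := eqVneq (FMonom s : word X Theta) w; rewrite /= ?mulr0n ?if_same.
Qed.

Lemma cls_linear : linear (@cls k X Theta : free_alg k X Theta -> F).
Proof. by move=> c g h; rewrite -(clsZ c g); apply: clsD. Qed.

Lemma even_part_linear : linear (@even_part k X Theta).
Proof.
move=> c; elim/FA2_ind=> g; elim/FA2_ind=> h.
rewrite -[X in even_part X](cls_linear c g h) !even_part_cls -[RHS]cls_linear.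
congr (cls _); apply/malgP => w; rewrite restrict_wordsE.
rewrite [in LHS]mcoeffD [in RHS]mcoeffD [in LHS]mcoeffZ [in RHS]mcoeffZ.
by rewrite !restrict_wordsE; case: ifP => _; rewrite ?mulr0 ?addr0.
Qed.

End FreeZ2Words.

Theorem proposition3p1 (k : fieldType)
    (char2 : 2%N \notin [pchar k]) (char3 : 3%N \notin [pchar k])
    (X Theta : choiceType) (le : rel (X + Theta))
    (le_order : total_order le)
    (theta_lt_x : forall (t : Theta) (x : X), strict le (inr t) (inl x)) :
  [/\ gj_algebra (@bullet k X Theta),
      gj_subalgebra (@bullet k X Theta) (@reversible k X Theta),
      gj_right_unital (@bullet k X Theta) (@reversible k X Theta)
    & @reversible k X Theta
      = gj_generated (@bullet k X Theta) (@generators k X Theta le)].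
Proof.
have two_neq0 : 2%:R != 0 :> k by move: char2; rewrite inE.
have x_nlt_theta x t : strict le (inl x) (inr t) = false.
  have [_ le_anti _ _] := le_order.
  apply/negbTE/negP => /andP [_ lxt]; have /andP [ne ltx] := theta_lt_x t x.
  by have := le_anti (inl x) (inr t); rewrite lxt ltx => /(_ isT).
pose W (s : seq (letter X Theta)) := \prod_(y <- s) gen k y.
have W_nil : W [::] = 1 by rewrite /W big_nil.
have W_cat s t : W (s ++ t) = W s * W t by apply: big_cat.
have W_span := @FA2_linear_ind k X Theta.
have W_eq0 := @monom_eq0 k X Theta.
have even_lin := @even_part_linear k X Theta.
have even_W := @even_part_monom k X Theta.
have star_lin := @star_linear k X Theta.
have star_W := @star_prod_gen k X Theta.
split.
- exact: bullet_gj_algebra two_neq0 W_span W_cat even_lin even_W.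
- exact: reversible_gj_subalgebra W_span W_cat even_lin even_W star_lin star_W.
- exact: reversible_gj_right_unital two_neq0 W_nil even_W star_W.
apply: (reversible_generated two_neq0 W_span W_nil W_cat W_eq0 even_lin even_W
  star_lin star_W le_order) => [a|||x1 x2 x3 x4].
- have brace_rev := brace_reversible star_lin star_W.
  case=> [->|[y ->]|[? [? [? [? [_ _ _ ->]]]]]|[? [? [? [? [_ _ ->]]]]]].
  + by rewrite -W_nil; apply: star_W.
  + by have := star_W [:: y]; rewrite /= big_seq1.
  + exact: brace_rev.
  + exact: brace_rev.
- by constructor 1.
- by move=> y; constructor 2; exists y; rewrite /W big_seq1.
(* At most one letter lies in [Theta], and in increasing order it must come first, which leaves only
   even and odd tetrads. *)
case: x1 x2 x3 x4 => [x1|t] [x2|?] [x3|?] [x4|?] //;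
  rewrite ?x_nlt_theta // => lt12 lt23 lt34 _.
- by constructor 3; exists x1, x2, x3, x4.
- by constructor 4; exists t, x2, x3, x4.
Qed.
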